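(* Let $(X,d,A)$ be a metric pair such that $(X/A,d_1,[A])$ is separable and not uniformly discrete, let $B=\widehat V(X,A)$, and let $(J,\Sigma)$ be admissible covariance data on $B$. Fix $t>0$. For every nonempty subset $S\subseteq K(X,A)$ and every $\varepsilon>0$, $$N_{\delta_{J,\Sigma,t}}(S,\varepsilon)\le N_{\rho}\!\left(S,\frac{\varepsilon}{\sqrt t\,\|\Sigma^{1/2}J\|}\right),$$ where $\|\Sigma^{1/2}J\|$ is the operator norm of $\Sigma^{1/2}J\colon(B,\|\cdot\|_{W_1})\to\ell^2$ (and the radius on the right is read as $+\infty$ if $\|\Sigma^{1/2}J\|=0$).
   Context: A metric pair $(X,d,A)$ is a metric space with a distinguished subset $A\subseteq X$. Put $d(x,A):=\inf_{a\in A}d(x,a)$ and $d_1(x,y):=\min\bigl(d(x,y),\,d(x,A)+d(y,A)\bigr)$. Let $X/A$ be the quotient collapsing $A$ to a point $[A]$; $d_1$ descends to $X/A$. Standing assumption: $A$ is nonempty and $d_1$ is a genuine metric on $X/A$ (i.e. $d(x,A)>0$ for $x\notin A$). A metric space is uniformly discrete if distances between distinct points are bounded below by some $\varepsilon>0$. $D(X,A):=D(X)/D(A)$, where $D(Y)$ is the free commutative monoid on $Y$. For $\alpha,\beta\in D(X,A)$, $W_1(\alpha,\beta):=\inf_\sigma\sum_{(x,y)\in\sigma}d_1(x,y)$ over $\sigma\in D(X\times X)$ whose marginals agree with $\alpha,\beta$ modulo $D(A)$. $K(X,A)$ is the Grothendieck group of $D(X,A)$ with translation-invariant metric $\rho(\alpha-\beta,\gamma-\delta):=W_1(\alpha+\delta,\gamma+\beta)$.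 It is the free abelian group with basis $(e_u)_{u\in X/A\setminus\{[A]\}}$. $V(X,A)=V(X)/V(A)$ ($V(Y)$ the free real vector space on $Y$) has basis $(e_u)_{u\in X/A\setminus\{[A]\}}$ and norm $\|\sum_uc_ue_u\|_{W_1}=\sup\{\sum_uc_uf(u): f\colon X/A\to\mathbb R,\ f([A])=0,\ \mathrm{Lip}_{d_1}(f)\le1\}$. $B=\widehat V(X,A)$ is its Banach completion (the Lipschitz-free space $\mathcal F(X/A,d_1)$). $K(X,A)\subset V(X,A)\subset B$ canonically, and $\rho(g,h)=\|g-h\|_{W_1}$ for $g,h\in K(X,A)$. Admissible covariance data $(J,\Sigma)$: fix a sequence $(\ell_n)_{n\ge1}\subset B^\ast$ with $\|\ell_n\|_{B^\ast}\le1$ that is norming ($\|x\|_{W_1}=\sup_n|\ell_n(x)|$ for all $x\in B$) and a strictly positive $(w_n)\in\ell^2$; $J\colon B\to\ell^2$, $Jx:=(w_n\ell_n(x))_n$. $\Sigma$ is the positive trace-class operator on $\ell^2$ with $\Sigma e_n=\sigma_ne_n$ in the standard basis, $\sigma_n\ge0$, $\sum_n\sigma_n<\infty$. For $t>0$, $k_{J,\Sigma,t}(x,y):=\exp\bigl(-\tfrac t2\|\Sigma^{1/2}J(x-y)\|_{\ell^2}^2\bigr)$ for $x,y\in B$, with reproducing kernel Hilbert space $H_{J,\Sigma,t}$. The feature (pseudo)metric is $\delta_{J,\Sigma,t}(x,y):=\|k_{J,\Sigma,t}(\cdot,x)-k_{J,\Sigma,t}(\cdot,y)\|_{H_{J,\Sigma,t}}=\sqrt{2-2k_{J,\Sigma,t}(x,y)}$,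 considered on $K(X,A)$. For a (pseudo)metric $m$ on $K(X,A)$, $N_m(S,\varepsilon)\in\mathbb N\cup\{\infty\}$ is the smallest number of open $m$-balls of radius $\varepsilon$ (centered in $K(X,A)$) that cover $S$. *)

(* Defs.v *)
From HB Require Import structures.
From mathcomp Require Import all_boot all_order all_algebra.
From mathcomp Require Import generic_quotient ring_quotient sesquilinear.
From mathcomp Require Import all_classical all_reals all_analysis.
From mathcomp Require Import finmap multiset.
From mathcomp.multinomials Require Import freeg.
From mathcomp Require Import lra.

Set Implicit Arguments.
Unset Strict Implicit.
Unset Printing Implicit Defensive.

Import Order.TTheory GRing.Theory Num.Theory.
Import numFieldNormedType.Exports.

Local Open Scope classical_set_scope.
Local Open Scope quotient_scope.
Local Open Scope ring_scope.

Definition dist_set (R : realType) (X : metricType R) (A : set X) (x : X) : R :=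
  inf [set mdist x a | a in A].

Record metricPair (R : realType) := MetricPair {
  mspace :> metricType R;
  msub : set mspace;
  msub_neq0 : msub !=set0;
  dist_msub_gt0 : forall x, ~ msub x -> 0 < dist_set msub x
}.

Section Collapse.
Context (R : realType) (P : metricPair R).
Implicit Types x y z a : P.
Local Notation A := (@msub R P).
Local Notation dA := (dist_set A).

Definition d1 x y : R := Num.min (mdist x y) (dA x + dA y).

Definition collapse_rel : rel P := fun x y => (x == y) || `[< A x /\ A y >].

Lemma collapse_equiv : equiv_class_of collapse_rel.
Proof.
rewrite /collapse_rel; split=> [x|x y|y x z]; first by rewrite eqxx.
  by rewrite eq_sym; congr orb; apply/asbool_equiv_eq; split=> -[].
move=> /orP[/eqP->//|/asboolP[Ax Ay]] /orP[/eqP<-|/asboolP[_ Az]];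
  by apply/orP; right; apply/asboolP.
Qed.

Canonical collapse_equivRel := EquivRelPack collapse_equiv.

Definition collapse : Type := {eq_quot collapse_rel}.
HB.instance Definition _ := Choice.on collapse.
HB.instance Definition _ := EqQuotient.on collapse.

Definition toq : P -> collapse := \pi_collapse.

Lemma toqP x y : toq x = toq y <-> x = y \/ A x /\ A y.
Proof.
rewrite /toq; split=> [/eqP|xy].
  by rewrite piE /= /collapse_rel => /orP[/eqP|/asboolP]; [left|right].
apply/eqP; rewrite piE /= /collapse_rel; case: xy => [->|xy].
  by rewrite eqxx.
by apply/orP; right; apply/asboolP.
Qed.

(* The point [A] of X/A; toq_base shows that the choice of a point of A is
   irrelevant. *)
Definition base : collapse := toq (projT1 (cid (@msub_neq0 R P))).

Lemma toq_base x : toq x = base <-> A x.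
Proof.
rewrite /base toqP; case: cid => a Aa /=; split=> [[->|[]]|] //.
by move=> Ax; right.
Qed.

Lemma dA_lb x : has_lbound [set mdist x a | a in A].
Proof. by exists 0 => _ [a _ <-]; exact: mdist_ge0. Qed.

Lemma dA_neq0 x : [set mdist x a | a in A] !=set0.
Proof. by have [a Aa] := @msub_neq0 R P; exists (mdist x a), a. Qed.

Lemma dA_ge0 x : 0 <= dA x.
Proof.
apply: lb_le_inf; first exact: dA_neq0.
by move=> _ [a _ <-]; exact: mdist_ge0.
Qed.

Lemma dA_eq0 x : dA x = 0 <-> A x.
Proof.
split=> [dx|Ax]; first by apply: contrapT => /dist_msub_gt0; rewrite dx ltxx.
apply/eqP; rewrite eq_le dA_ge0 andbT -(mdistxx x).
by apply: ge_inf; [exact: dA_lb|exists x].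
Qed.

Lemma dA_le x y : dA x <= mdist x y + dA y.
Proof.
rewrite -lerBlDl; apply: lb_le_inf; first exact: dA_neq0.
move=> _ [a Aa <-]; rewrite lerBlDl.
apply: le_trans (metric_triangle x y a).
by apply: ge_inf; [exact: dA_lb|exists a].
Qed.

Lemma d1_sym x y : d1 x y = d1 y x.
Proof. by rewrite /d1 metric_sym addrC. Qed.

Lemma d1_ge0 x y : 0 <= d1 x y.
Proof. by rewrite le_min mdist_ge0 addr_ge0 ?dA_ge0. Qed.

Lemma d1_triangle y x z : d1 x z <= d1 x y + d1 y z.
Proof.
have := metric_triangle x y z; have := dA_le x y; have := dA_le z y.
rewrite (metric_sym z y) => *; have ? := dA_ge0 y.
by rewrite /d1 ge_min; case: (leP (mdist x y)) => ?; case: (leP (mdist y z)) => ?; apply/orP;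
  (left; lra) || (right; lra).
Qed.

Lemma d1_eq0 x y : (d1 x y = 0) <-> (x = y \/ A x /\ A y).
Proof.
split=> [|[->|[Ax Ay]]].
- rewrite /d1; case: (leP (mdist x y)) => _; first by move/mdist_positivity; left.
  move=> /eqP; rewrite paddr_eq0 ?dA_ge0// => /andP[/eqP/dA_eq0 ? /eqP/dA_eq0 ?].
  by right.
- by apply/eqP; rewrite eq_le d1_ge0 andbT ge_min mdistxx lexx.
- apply/eqP; rewrite eq_le d1_ge0 andbT ge_min; apply/orP; right.
  by move: Ax Ay => /dA_eq0-> /dA_eq0->; rewrite addr0.
Qed.

Definition d1q (u v : collapse) : R := d1 (repr u) (repr v).

Lemma d1_congr x x' y y' : toq x = toq x' -> toq y = toq y' -> d1 x y = d1 x' y'.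
Proof.
have H a b c : toq a = toq b -> d1 a c <= d1 b c.
  move=> /toqP/d1_eq0 ab; apply: le_trans (d1_triangle b a c) _.
  by rewrite ab add0r.
have E a b c : toq a = toq b -> d1 a c = d1 b c.
  by move=> ab; apply/eqP; rewrite eq_le !H.
by move=> /E-> /E; rewrite d1_sym => ->; rewrite d1_sym.
Qed.

Lemma toq_repr (u : collapse) : toq (repr u) = u.
Proof. exact: reprK. Qed.

Lemma d1q_toq x y : d1q (toq x) (toq y) = d1 x y.
Proof. by apply: d1_congr; rewrite toq_repr. Qed.

Fact d1qxx u : d1q u u = 0.
Proof. by apply/d1_eq0; left. Qed.

Fact d1q_positivity u v : d1q u v = 0 -> u = v.
Proof. by move/d1_eq0/toqP; rewrite !toq_repr. Qed.

Fact d1q_sym u v : d1q u v = d1q v u.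
Proof. exact: d1_sym. Qed.

Fact d1q_triangle v u w : d1q u w <= d1q u v + d1q v w.
Proof. exact: d1_triangle. Qed.

HB.instance Definition _ :=
  isMetric.Build R collapse d1qxx d1q_positivity d1q_sym d1q_triangle.

Lemma mdist_toq x y : mdist (toq x) (toq y) = d1 x y.
Proof. exact: d1q_toq. Qed.

End Collapse.

Definition separable (T : topologicalType) : Prop :=
  exists2 D : set T, countable D & dense D.

Definition uniformly_discrete (R : realType) (T : metricType R) : Prop :=
  exists2 e : R, 0 < e & forall u v : T, u <> v -> e <= mdist u v.

Section MonoidQuotient.
Context (N : nmodType) (S : addrClosed N).
Implicit Types x y : N.

Definition mquot_rel : rel N :=
  fun x y => `[< exists a b, [/\ a \in S, b \in S & x + a = y + b] >].

Lemma mquot_equiv : equiv_class_of mquot_rel.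
Proof.
split=> [x|x y|y x z].
- by apply/asboolP; exists 0, 0; split; rewrite ?rpred0.
- by apply/asbool_equiv_eq; split=> -[a [b [? ? ?]]]; exists b, a.
- move=> /asboolP[a [b [aS bS ab]]] /asboolP[c [d [cS dS cd]]].
  apply/asboolP; exists (a + c), (d + b); split; rewrite ?rpredD//.
  by rewrite addrA ab addrAC cd addrA.
Qed.

Canonical mquot_equivRel := EquivRelPack mquot_equiv.
Canonical mquot_encModRel := defaultEncModRel mquot_rel.

Definition mquot : Type := {eq_quot mquot_rel}.
HB.instance Definition _ := Choice.on mquot.
HB.instance Definition _ := EqQuotient.on mquot.

Definition to_mquot : N -> mquot := \pi_mquot.

Lemma to_mquotP x y : to_mquot x = to_mquot y <->
  exists a b, [/\ a \in S, b \in S & x + a = y + b].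
Proof.
rewrite /to_mquot; split=> [/eqP|xy]; first by rewrite piE => /asboolP.
by apply/eqP; rewrite piE; apply/asboolP.
Qed.

Lemma mquot_repr (q : mquot) : to_mquot (repr q) = q.
Proof. exact: reprK. Qed.

Definition mquot_add (p q : mquot) : mquot := to_mquot (repr p + repr q).

Lemma to_mquot_add x y : mquot_add (to_mquot x) (to_mquot y) = to_mquot (x + y).
Proof.
apply/to_mquotP.
have /to_mquotP[a [b [aS bS ab]]] := mquot_repr (to_mquot x).
have /to_mquotP[c [d [cS dS cd]]] := mquot_repr (to_mquot y).
by exists (a + c), (b + d); split; rewrite ?rpredD// addrACA ab cd addrACA.
Qed.

Fact mquot_addA : associative mquot_add.
Proof.
move=> p q r; rewrite -(mquot_repr p) -(mquot_repr q) -(mquot_repr r).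
by rewrite !to_mquot_add addrA.
Qed.

Fact mquot_addC : commutative mquot_add.
Proof. by move=> p q; rewrite /mquot_add addrC. Qed.

Fact mquot_add0 : left_id (to_mquot 0) mquot_add.
Proof. by move=> p; rewrite -(mquot_repr p) to_mquot_add add0r. Qed.

HB.instance Definition _ :=
  GRing.isNmodule.Build mquot mquot_addA mquot_addC mquot_add0.

Lemma to_mquotD x y : to_mquot (x + y) = to_mquot x + to_mquot y.
Proof. by rewrite -to_mquot_add. Qed.

Lemma to_mquot0 : to_mquot 0 = 0.
Proof. by []. Qed.

End MonoidQuotient.

Section Grothendieck.
Context (N : nmodType).
Implicit Types x y : N.

Definition groth_rel : rel (N * N) :=
  fun p q => `[< exists k, p.1 + q.2 + k = q.1 + p.2 + k >].

Lemma groth_equiv : equiv_class_of groth_rel.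
Proof.
split=> [p|p q|q p r]; first by apply/asboolP; exists 0.
  by apply/asbool_equiv_eq; split=> -[k ?]; exists k.
move=> /asboolP[k pq] /asboolP[l qr].
apply/asboolP; exists (q.2 + k + l + q.1).
rewrite !addrA [LHS](ACl (1*3*4*6*2*5)%AC)/= pq.
rewrite -!addrA [X in _ + (_ + (_ + X))]addrA qr !addrA.
by rewrite [LHS](ACl (4*2*5*3*6*1)%AC).
Qed.

Canonical groth_equivRel := EquivRelPack groth_equiv.
Canonical groth_encModRel := defaultEncModRel groth_rel.

Definition groth : Type := {eq_quot groth_rel}.
HB.instance Definition _ := Choice.on groth.
HB.instance Definition _ := EqQuotient.on groth.

Definition gdiff x y : groth := \pi_groth (x, y).

Lemma gdiffP x y x' y' : gdiff x y = gdiff x' y' <->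
  exists k, x + y' + k = x' + y + k.
Proof.
rewrite /gdiff; split=> [/eqP|xy]; first by rewrite piE => /asboolP.
by apply/eqP; rewrite piE; apply/asboolP.
Qed.

Lemma gdiff_repr (g : groth) : gdiff (repr g).1 (repr g).2 = g.
Proof. by rewrite /gdiff -surjective_pairing reprK. Qed.

Definition groth_add (g h : groth) : groth :=
  gdiff ((repr g).1 + (repr h).1) ((repr g).2 + (repr h).2).
Definition groth_opp (g : groth) : groth := gdiff (repr g).2 (repr g).1.

Lemma gdiff_add x y x' y' :
  groth_add (gdiff x y) (gdiff x' y') = gdiff (x + x') (y + y').
Proof.
apply/gdiffP.
have /gdiffP[k kE] := gdiff_repr (gdiff x y).
have /gdiffP[l lE] := gdiff_repr (gdiff x' y').
exists (k + l); move: kE lE.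
set a := (repr _).1; set b := (repr _).2.
set c := (repr _).1; set d := (repr _).2 => kE lE.
rewrite !addrA [LHS](ACl ((1*3*5)*(2*4*6))%AC)/= kE lE !addrA.
by rewrite [LHS](ACl (1*4*2*5*3*6)%AC).
Qed.

Lemma gdiff_opp x y : groth_opp (gdiff x y) = gdiff y x.
Proof.
apply/gdiffP; have /gdiffP[k kE] := gdiff_repr (gdiff x y).
by exists k; rewrite [in LHS](addrC (repr _).2) -kE [in RHS](addrC y).
Qed.

Fact groth_addA : associative groth_add.
Proof.
move=> p q r; rewrite -(gdiff_repr p) -(gdiff_repr q) -(gdiff_repr r).
by rewrite !gdiff_add !addrA.
Qed.

Fact groth_addC : commutative groth_add.
Proof. by move=> p q; rewrite /groth_add addrC [X in gdiff _ X]addrC. Qed.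

Fact groth_add0 : left_id (gdiff 0 0) groth_add.
Proof. by move=> p; rewrite -(gdiff_repr p) gdiff_add !add0r. Qed.

Fact groth_addN : left_inverse (gdiff 0 0) groth_opp groth_add.
Proof.
move=> p; rewrite -(gdiff_repr p) gdiff_opp gdiff_add.
by apply/gdiffP; exists 0; rewrite !addr0 add0r addrC.
Qed.

HB.instance Definition _ :=
  GRing.isZmodule.Build groth groth_addA groth_addC groth_add0 groth_addN.

End Grothendieck.

Section ModuleQuotient.
Context (F : pzRingType) (U : lmodType F) (W : submodClosed U).
Implicit Types (u v : U) (c : F).

Let Wz : {pred U} := W.
Fact lquot_zmod_closed : zmod_closed Wz.
Proof.
split=> [|u v uW vW]; first exact: rpred0.
by rewrite /Wz -scaleN1r addrC; apply: rpredD => //; apply: rpredZ.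
Qed.
HB.instance Definition _ := GRing.isZmodClosed.Build U Wz lquot_zmod_closed.

Definition lquot : Type := Quotient.quot Wz.
HB.instance Definition _ := GRing.Zmodule.on lquot.

Definition to_lquot : U -> lquot := \pi_(Quotient.quot Wz).

Lemma to_lquotP u v : to_lquot u = to_lquot v <-> u - v \in W.
Proof.
rewrite /to_lquot -[_ \in W]/(u - v \in Wz) Quotient.idealrBE.
by split=> [->|/eqP].
Qed.

Definition lquot_repr (q : lquot) : U := repr (q : Quotient.quot Wz).

Lemma lquot_reprK q : to_lquot (lquot_repr q) = q.
Proof. exact: reprK. Qed.

Definition lquot_scale c (q : lquot) : lquot := to_lquot (c *: lquot_repr q).

Lemma lquot_scaleE c u : lquot_scale c (to_lquot u) = to_lquot (c *: u).
Proof.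
apply/to_lquotP; rewrite -scalerBr rpredZ//.
by apply/to_lquotP; rewrite lquot_reprK.
Qed.

Lemma to_lquotD : {morph to_lquot : u v / u + v}.
Proof. exact: raddfD. Qed.

Fact lquot_scaleA c d q : lquot_scale c (lquot_scale d q) = lquot_scale (c * d) q.
Proof. by rewrite -(lquot_reprK q) !lquot_scaleE scalerA. Qed.

Fact lquot_scale1 : left_id 1 lquot_scale.
Proof. by move=> q; rewrite -(lquot_reprK q) lquot_scaleE scale1r. Qed.

Fact lquot_scaleDr : right_distributive lquot_scale +%R.
Proof.
move=> c p q; rewrite -(lquot_reprK p) -(lquot_reprK q).
by rewrite -to_lquotD !lquot_scaleE -to_lquotD scalerDr.
Qed.

Fact lquot_scaleDl q : {morph lquot_scale^~ q : c d / c + d}.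
Proof.
by move=> c d; rewrite -(lquot_reprK q) !lquot_scaleE -to_lquotD scalerDl.
Qed.

HB.instance Definition _ := GRing.Zmodule_isLmodule.Build F lquot
  lquot_scaleA lquot_scale1 lquot_scaleDr lquot_scaleDl.

Fact to_lquot_linear : linear to_lquot.
Proof. by move=> c u v; rewrite to_lquotD -lquot_scaleE. Qed.

HB.instance Definition _ := GRing.isLinear.Build F U lquot *:%R to_lquot
  to_lquot_linear.

End ModuleQuotient.

(* The free commutative monoid on T. *)
Definition freeCM (T : choiceType) : Type := {mset T}%mset.

Section FreeCM.
Context (T : choiceType).
Implicit Types m n : {mset T}%mset.

HB.instance Definition _ := Choice.on (freeCM T).
HB.instance Definition _ := GRing.isNmodule.Build (freeCM T)
  (@msetDA T) (@msetDC T) (@mset0D T).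

Definition fcm_gen (x : T) : freeCM T := [mset x]%mset.

Lemma fcmDE (m n : freeCM T) (x : T) : (m + n : multiset T) x = (m x + n x)%N.
Proof. by rewrite [(m + n)%R]/(msetD m n) msetE2. Qed.

Lemma fcm_addIr (k : freeCM T) : injective (+%R^~ k).
Proof.
move=> m n mn; apply/msetP => x.
by apply: (@addIn (k x)); rewrite -!fcmDE mn.
Qed.

Lemma fcm_genE (x y : T) : (fcm_gen x : multiset T) y = (y == x).
Proof. by rewrite msetnE; case: eqP. Qed.

Lemma fcm_rem (m : freeCM T) (x : T) : x \in (m : multiset T) ->
  exists n : freeCM T, m = fcm_gen x + n.
Proof. by move=> xm; exists (m `\ x)%mset; rewrite -[LHS](msetB1K xm). Qed.

Lemma fcm_ind (Q : freeCM T -> Prop) : Q 0 ->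
  (forall x m, Q m -> Q (fcm_gen x + m)) -> forall m, Q m.
Proof.
move=> Q0 QS m; rewrite -[m](@seq_mset_id T).
elim: (enum_mset m) => [|x s ih].
  suff -> : seq_mset [::] = 0 :> freeCM T by [].
  by apply/msetP => y; rewrite mset_seqE mset0E.
have -> : seq_mset (x :: s) = fcm_gen x + (seq_mset s : freeCM T).
  exact: mset_cons.
exact: QS.
Qed.

Lemma fcm_big (M : nmodType) (F : T -> M) (m n : freeCM T) :
  \sum_(x <- (m + n : multiset T)) F x =
  \sum_(x <- (m : multiset T)) F x + \sum_(x <- (n : multiset T)) F x.
Proof.
rewrite -big_cat; apply: perm_big; apply/allP => x _ /=.
by rewrite count_cat !count_mem_mset fcmDE.
Qed.

Lemma fcm_big_gen (M : nmodType) (F : T -> M) (y : T) :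
  \sum_(x <- (fcm_gen y : multiset T)) F x = F y.
Proof. by rewrite enum_msetn big_seq1. Qed.

Lemma fcm_big0 (M : nmodType) (F : T -> M) :
  \sum_(x <- ((0 : freeCM T) : multiset T)) F x = 0.
Proof. by rewrite enum_mset0 big_nil. Qed.

End FreeCM.

Definition fcm_map (T T' : choiceType) (f : T -> T') (m : freeCM T) : freeCM T' :=
  \sum_(x <- (m : multiset T)) fcm_gen (f x).

Lemma fcm_mapD (T T' : choiceType) (f : T -> T') : {morph fcm_map f : m n / m + n}.
Proof. by move=> m n; rewrite /fcm_map fcm_big. Qed.

Lemma fcm_map_gen (T T' : choiceType) (f : T -> T') x :
  fcm_map f (fcm_gen x) = fcm_gen (f x).
Proof. by rewrite /fcm_map fcm_big_gen. Qed.

Lemma fcm_map0 (T T' : choiceType) (f : T -> T') : fcm_map f 0 = 0.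
Proof. by rewrite /fcm_map fcm_big0. Qed.

Lemma mem_fcm_map (T T' : choiceType) (f : T -> T') (m : freeCM T) y :
  y \in (fcm_map f m : multiset T') -> exists2 x, x \in (m : multiset T) & y = f x.
Proof.
elim/fcm_ind: m => [|x m ih]; first by rewrite fcm_map0 in_mset0.
rewrite fcm_mapD fcm_map_gen in_mset fcmDE addn_gt0 fcm_genE.
move=> /orP[|]; last first.
  rewrite -in_mset => /ih[z zm ->]; exists z => //.
  by rewrite in_mset fcmDE addn_gt0 orbC -in_mset zm.
by case: eqP => // -> _; exists x => //; rewrite in_mset fcmDE fcm_genE eqxx.
Qed.

Section Wasserstein.
Context (R : realType) (P : metricPair R).
Local Notation A := (@msub R P).

Definition DA : {pred freeCM P} :=
  fun m => `[< forall x, x \in (m : multiset P) -> A x >].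

Lemma DAP (m : freeCM P) : reflect (forall x, x \in (m : multiset P) -> A x) (m \in DA).
Proof. exact: asboolP. Qed.

Fact DA_closed : GRing.nmod_closed DA.
Proof.
split=> [|m n /DAP mA /DAP nA]; apply/DAP => x; first by rewrite in_mset0.
by rewrite in_mset fcmDE addn_gt0 -!in_mset => /orP[/mA|/nA].
Qed.
HB.instance Definition _ := GRing.isAddClosed.Build (freeCM P) DA DA_closed.

Definition DXA : nmodType := mquot DA.
Definition toD : freeCM P -> DXA := to_mquot DA.

Lemma toDD : {morph toD : m n / m + n}. Proof. exact: to_mquotD. Qed.

Definition marg1 (s : freeCM (P * P)%type) : DXA := toD (fcm_map fst s).
Definition marg2 (s : freeCM (P * P)%type) : DXA := toD (fcm_map snd s).
Definition cost (s : freeCM (P * P)%type) : R :=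
  \sum_(p <- (s : multiset (P * P)%type)) d1 p.1 p.2.

Definition coupling (a b : DXA) : set (freeCM (P * P)%type) :=
  [set s | marg1 s = a /\ marg2 s = b].

Definition W1 (a b : DXA) : R := inf [set cost s | s in coupling a b].

Definition KXA : zmodType := groth DXA.

(* rho is computed on representatives; rhoE below shows that the choice is
   irrelevant. *)
Definition rho (g h : KXA) : R :=
  W1 ((repr g).1 + (repr h).2) ((repr h).1 + (repr g).2).

Lemma marg1D : {morph marg1 : s t / s + t}.
Proof. by move=> s t; rewrite /marg1 fcm_mapD toDD. Qed.

Lemma marg2D : {morph marg2 : s t / s + t}.
Proof. by move=> s t; rewrite /marg2 fcm_mapD toDD. Qed.

Lemma costD : {morph cost : s t / s + t}.
Proof. by move=> s t; rewrite /cost fcm_big. Qed.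

Lemma cost_gen p : cost (fcm_gen p) = d1 p.1 p.2.
Proof. by rewrite /cost fcm_big_gen. Qed.

Lemma cost_ge0 s : 0 <= cost s.
Proof. by apply: sumr_ge0 => p _; exact: d1_ge0. Qed.

Lemma toD_gen0 x : A x -> toD (fcm_gen x) = 0.
Proof.
move=> Ax; apply/to_mquotP; exists 0, (fcm_gen x).
split; rewrite ?rpred0//; first by apply/DAP => y /mset1P->.
by rewrite addrC.
Qed.

Lemma DXA_addIr (k : DXA) : injective (+%R^~ k).
Proof.
move=> a b.
rewrite -(mquot_repr a) -(mquot_repr b) -(mquot_repr k) -!to_mquotD.
move=> /to_mquotP[c [d [cA dA E]]].
apply/to_mquotP; exists c, d; split => //.
by apply: (@fcm_addIr _ (repr k)); rewrite addrAC E addrAC.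
Qed.

Lemma coupling_neq0 a b : coupling a b !=set0.
Proof.
have [x0 Ax0] := @msub_neq0 R P.
have cpll (m : freeCM P) : exists s, marg1 s = toD m /\ marg2 s = 0.
  elim/fcm_ind: m => [|x m [s [s1 s2]]].
    by exists 0; rewrite /marg1 /marg2 !fcm_map0.
  exists (fcm_gen (x, x0) + s); rewrite marg1D marg2D s1 s2 toDD.
  by rewrite /marg1 /marg2 !fcm_map_gen/= (toD_gen0 Ax0) addr0.
have cplr (m : freeCM P) : exists s, marg1 s = 0 /\ marg2 s = toD m.
  elim/fcm_ind: m => [|x m [s [s1 s2]]].
    by exists 0; rewrite /marg1 /marg2 !fcm_map0.
  exists (fcm_gen (x0, x) + s); rewrite marg1D marg2D s1 s2 toDD.
  by rewrite /marg1 /marg2 !fcm_map_gen/= (toD_gen0 Ax0) addr0.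
have [s [s1 s2]] := cpll (repr a); have [t [t1 t2]] := cplr (repr b).
exists (s + t); rewrite /coupling/= marg1D marg2D s1 s2 t1 t2 addr0 add0r.
by split; exact: mquot_repr.
Qed.

Lemma cost_neq0 a b : [set cost s | s in coupling a b] !=set0.
Proof. by have [s st] := coupling_neq0 a b; exists (cost s), s. Qed.

Lemma cost_lb a b : has_lbound [set cost s | s in coupling a b].
Proof. by exists 0 => _ [s _ <-]; exact: cost_ge0. Qed.

(* A coupling of a + z and b + z can be rerouted through z. *)
Lemma coupling_cancel (z : P) a b s :
  coupling (a + toD (fcm_gen z)) (b + toD (fcm_gen z)) s ->
  exists2 s', coupling a b s' & cost s' <= cost s.
Proof.
move=> [s1 s2]; have [Az|nAz] := pselect (A z).
  by exists s => //; move: s1 s2; rewrite (toD_gen0 Az) !addr0.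
have mem_of (m : freeCM P) c : toD m = c + toD (fcm_gen z) ->
    z \in (m : multiset P).
  rewrite -(mquot_repr c) -toDD => /to_mquotP[e [f [/DAP eA /DAP fA E]]].
  have : z \in ((repr c + fcm_gen z + f : freeCM P) : multiset P).
    by rewrite in_mset !fcmDE fcm_genE eqxx addn1 addnC addnS.
  by rewrite -E in_mset fcmDE addn_gt0 -!in_mset => /orP[//|/eA].
have /mem_fcm_map[p ps pz] := mem_of _ _ s1.
have /mem_fcm_map[q qs qz] := mem_of _ _ s2.
have [r rE] := fcm_rem ps.
have [pq|pq] := pselect (p = q).
  exists r.
    split; apply: (@DXA_addIr (toD (fcm_gen z))).
      by rewrite -s1 rE marg1D /marg1 fcm_map_gen -pz addrC.
    by rewrite -s2 rE marg2D /marg2 fcm_map_gen pq -qz addrC.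
  by rewrite rE costD lerDr cost_gen d1_ge0.
have qr : q \in (r : multiset (P * P)%type).
  move: qs; rewrite rE in_mset fcmDE fcm_genE.
  by case: eqP => [/esym/pq//|_]; rewrite add0n in_mset.
have [t tE] := fcm_rem qr.
exists (fcm_gen (q.1, p.2) + t).
  split; apply: (@DXA_addIr (toD (fcm_gen z))).
    rewrite -s1 rE tE !marg1D /marg1 !fcm_map_gen/= -pz.
    by rewrite addrC.
  rewrite -s2 rE tE !marg2D /marg2 !fcm_map_gen/= -qz.
  by rewrite -addrA [toD _ + toD (fcm_gen z)]addrC.
rewrite rE tE !costD !cost_gen/= addrA lerD2r -pz -qz addrC.
exact: d1_triangle.
Qed.

Lemma W1_translate k a b : W1 (a + k) (b + k) = W1 a b.
Proof.
rewrite -(mquot_repr k) -/toD; elim/fcm_ind: (repr k) a b => [|z m ih] a b.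
  by rewrite [toD 0]to_mquot0 !addr0.
rewrite toDD !addrA ih; apply/eqP; rewrite eq_le; apply/andP; split.
- apply: lb_le_inf => [|_ [s [s1 s2] <-]]; first exact: cost_neq0.
  apply: ge_inf; first exact: cost_lb.
  exists (fcm_gen (z, z) + s).
    split; first by rewrite marg1D s1 /marg1 fcm_map_gen addrC.
    by rewrite marg2D s2 /marg2 fcm_map_gen addrC.
  rewrite costD cost_gen/= (_ : d1 z z = 0) ?add0r//.
  by apply/d1_eq0; left.
- apply: lb_le_inf => [|_ [s /coupling_cancel[s' s'ab ss'] <-]].
    exact: cost_neq0.
  by apply: le_trans ss'; apply: ge_inf; [exact: cost_lb|exists s'].
Qed.

Lemma rhoE (a b c d : DXA) : rho (gdiff a b) (gdiff c d) = W1 (a + d) (c + b).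
Proof.
rewrite /rho.
have /gdiffP[k /DXA_addIr] := gdiff_repr (gdiff a b).
have /gdiffP[l /DXA_addIr] := gdiff_repr (gdiff c d).
set h := repr _; set g := repr _ => hE gE.
rewrite -(W1_translate (b + d)) -[RHS](W1_translate (g.2 + h.2)).
congr W1.
  by rewrite [LHS]addrACA gE [RHS]addrACA [d + _]addrC.
by rewrite [b + d]addrC [LHS]addrACA hE [g.2 + h.2]addrC [RHS]addrACA [g.2 + b]addrC.
Qed.

End Wasserstein.

Section FreeVector.
Context (R : realType) (P : metricPair R).
Local Notation A := (@msub R P).
Local Notation VX := {freeg P / R}.
Implicit Types (v w : VX) (f : collapse P -> R).

Definition VA : {pred VX} := fun v => `[< forall x, coeff x v != 0 -> A x >].

Lemma VAP v : reflect (forall x, coeff x v != 0 -> A x) (v \in VA).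
Proof. exact: asboolP. Qed.

Fact VA_closed : submod_closed VA.
Proof.
split=> [|c v w /VAP vA /VAP wA]; apply/VAP => x; first by rewrite coeff0 eqxx.
rewrite coeffD coeffZ; have [v0|/vA//] := eqVneq (coeff x v) 0.
by rewrite v0 mulr0 add0r => /wA.
Qed.
HB.instance Definition _ := GRing.isSubmodClosed.Build R VX VA VA_closed.

Definition VXA : lmodType R := lquot VA.
Definition toV : VX -> VXA := to_lquot VA.

(* The basis vectors e_u; e_[A] = 0. *)
Definition evec (u : collapse P) : VXA := toV << 1 *g repr u >>.

(* The linear functional on V(X,A) with e_u |-> f u, for f [A] = 0. *)
Definition vpair f (q : VXA) : R :=
  let v := lquot_repr q in \sum_(x <- dom v) coeff x v * f (toq x).

Definition Lip1_based : set (collapse P -> R) :=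
  [set f | f (base P) = 0 /\ forall p q, `|f p - f q| <= mdist p q].

(* The W_1 norm; extended-real valued so that the supremum needs no
   boundedness proof. *)
Definition W1norm (q : VXA) : \bar R :=
  ereal_sup [set (vpair f q)%:E | f in Lip1_based].

Let vsum f v : R := \sum_(x <- dom v) coeff x v * f (toq x).

Let vsumE f v (s : seq P) : uniq s -> {subset dom v <= s} ->
  vsum f v = \sum_(x <- s) coeff x v * f (toq x).
Proof.
move=> us sub; rewrite [RHS](bigID (mem (dom v)))/= [X in _ + X]big1 ?addr0.
  rewrite /vsum -[RHS]big_filter; apply: perm_big.
  apply: uniq_perm; rewrite ?uniq_dom ?filter_uniq// => x.
  by rewrite mem_filter; apply/idP/andP => [xv|[]//]; split => //; exact: sub.
by move=> x /coeff_outdom ->; rewrite mul0r.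
Qed.

Let vsum_linear f : linear_for *%R (vsum f).
Proof.
move=> c v w; set s := undup (dom (c *: v + w) ++ dom v ++ dom w).
have us : uniq s by exact: undup_uniq.
have sub z : {subset dom z <= dom (c *: v + w) ++ dom v ++ dom w} ->
    {subset dom z <= s} by move=> h x /h; rewrite mem_undup.
rewrite !(vsumE _ us); try by apply: sub => x xd; rewrite !mem_cat xd ?orbT.
rewrite mulr_sumr -big_split/=; apply: eq_bigr => x _.
by rewrite coeffD coeffZ mulrDl mulrA.
Qed.

Lemma vpair_toV f v : f (base P) = 0 ->
  vpair f (toV v) = \sum_(x <- dom v) coeff x v * f (toq x).
Proof.
move=> f0; rewrite /vpair -/(vsum f v) -/(vsum f _).
have /to_lquotP := lquot_reprK (toV v); set w := lquot_repr _ => /VAP wv.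
have -> : w = 1 *: (w - v) + v by rewrite scale1r subrK.
rewrite vsum_linear mul1r /vsum big_seq big1 ?add0r// => x.
by rewrite mem_dom => /wv /toq_base->; rewrite f0 mulr0.
Qed.

Lemma vpair_linear f : f (base P) = 0 -> linear_for *%R (vpair f).
Proof.
move=> f0 c p q; rewrite -(lquot_reprK p) -(lquot_reprK q) -linearP.
by rewrite !(vpair_toV _ f0); exact: vsum_linear.
Qed.

Lemma vpair_evec f u : f (base P) = 0 -> vpair f (evec u) = f u.
Proof.
move=> f0; rewrite (vpair_toV _ f0) domU ?oner_eq0// big_seq1.
by rewrite coeffU eqxx mulr1 mul1r toq_repr.
Qed.

Lemma evec_toq x : evec (toq x) = toV << 1 *g x >>.
Proof.
apply/to_lquotP/VAP => y; rewrite coeffB !coeffU !mul1r.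
have /toqP[->|[Ar Ax]] := toq_repr (toq x); first by rewrite subrr eqxx.
case: (eqVneq (repr (toq x)) y) => [<-//|_].
by case: (eqVneq x y) => [<-//|_]; rewrite subrr eqxx.
Qed.

Definition DtoV (a : DXA P) : VXA :=
  \sum_(x <- (repr a : multiset P)) toV << 1 *g x >>.
Definition KtoV (g : KXA P) : VXA := DtoV (repr g).1 - DtoV (repr g).2.

Lemma DtoV_toD (m : freeCM P) :
  DtoV (toD m) = \sum_(x <- (m : multiset P)) evec (toq x).
Proof.
have DA0 (n : freeCM P) : n \in @DA R P ->
    \sum_(x <- (n : multiset P)) toV << 1 *g x >> = 0.
  move=> /DAP nA; rewrite big_seq big1// => x /nA Ax.
  rewrite (_ : 0 = toV 0); last by rewrite /toV linear0.
  apply/to_lquotP/VAP => y.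
  by rewrite subr0 coeffU mul1r; case: (eqVneq x y) => [<-|]; rewrite ?eqxx.
rewrite /DtoV; have /to_mquotP[a [b [aA bA E]]] := mquot_repr (toD m).
transitivity (\sum_(x <- (repr (toD m) + a : multiset P)) toV << 1 *g x >>).
  by rewrite fcm_big (DA0 _ aA) addr0.
rewrite E fcm_big (DA0 _ bA) addr0.
by apply: eq_bigr => x _; rewrite evec_toq.
Qed.

Lemma DtoVD : {morph DtoV : a b / a + b}.
Proof.
move=> a b; rewrite -(mquot_repr a) -(mquot_repr b) -to_mquotD.
by rewrite !DtoV_toD fcm_big.
Qed.

Lemma KtoV_gdiff (a b : DXA P) : KtoV (gdiff a b) = DtoV a - DtoV b.
Proof.
have /gdiffP[k /DXA_addIr E] := gdiff_repr (gdiff a b).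
by apply/eqP; rewrite /KtoV subr_eq addrAC -subr_eq opprK -!DtoVD E.
Qed.

Lemma KtoVB : {morph KtoV : g h / g - h}.
Proof.
move=> g h; rewrite -(gdiff_repr g) -(gdiff_repr h).
rewrite [- gdiff _ _]gdiff_opp [gdiff _ _ + _]gdiff_add !KtoV_gdiff !DtoVD.
by rewrite !opprD opprK addrACA [X in _ + X]addrC.
Qed.

End FreeVector.

(* A Banach completion of V(X,A); it is unique up to a linear isometry
   compatible with the embedding. *)
Record completion (R : realType) (P : metricPair R) := Completion {
  cspace :> completeNormedModType R;
  cembed : {linear VXA P -> cspace};
  cembed_isometry : forall q, (`|cembed q|)%:E = W1norm q;
  cembed_dense : dense (range cembed)
}.

Definition opnorm (R : realType) (E : normedModType R) (F : Type) (nF : F -> R)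
    (T : E -> F) : \bar R :=
  ereal_sup [set (nF (T x))%:E | x in [set x : E | `|x| <= 1]].

Section Sequences.
Context (R : realType).
Implicit Types u s : nat -> R.

Definition l2 : set (nat -> R) :=
  [set u : nat -> R | cvgn (series (fun n => u n ^+ 2))].
Definition l2norm u : R := Num.sqrt (limn (series (fun n => u n ^+ 2))).

Definition diagop s u : nat -> R := fun n => s n * u n.

End Sequences.

(* Sequences are indexed from 0. *)
Record covData (R : realType) (B : normedModType R) := CovData {
  ell : nat -> {linear B -> R^o};
  ell_le1 : forall n, (opnorm (fun r : R^o => `|r|%R) (ell n) <= 1%:E)%E;
  ell_norming : forall x, (`|x|)%:E = ereal_sup (range (fun n => (`|ell n x|)%:E));
  wgt : nat -> R;
  wgt_gt0 : forall n, 0 < wgt n;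
  wgt_l2 : l2 wgt;
  sig : nat -> R;
  sig_ge0 : forall n, 0 <= sig n;
  sig_summable : cvgn (series sig)
}.

Section Covariance.
Context (R : realType) (B : normedModType R) (C : covData B).

Definition Jop (x : B) : nat -> R := fun n => wgt C n * ell C n x.

Definition Sigma : (nat -> R) -> (nat -> R) := diagop (sig C).

(* The positive square root of a nonnegative diagonal operator is diagonal. *)
Definition sqrtSigma : (nat -> R) -> (nat -> R) :=
  diagop (fun n => Num.sqrt (sig C n)).

Definition SJ (x : B) : nat -> R := sqrtSigma (Jop x).

Definition SJnorm : \bar R := opnorm (@l2norm R) SJ.

Definition kJS (t : R) (x y : B) : R := expR (- (t / 2 * l2norm (SJ (x - y)) ^+ 2)).

Lemma sqrtSigmaK u : sqrtSigma (sqrtSigma u) = Sigma u.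
Proof.
apply/funext => n; rewrite /sqrtSigma /Sigma /diagop mulrA -expr2.
by rewrite sqr_sqrtr// sig_ge0.
Qed.

Lemma ell_le (n : nat) (x : B) : `|ell C n x| <= `|x|.
Proof.
by rewrite -lee_fin [leRHS](ell_norming C x); apply: ereal_sup_ubound; exists n.
Qed.

Lemma Jop_l2 x : l2 (Jop x).
Proof.
apply: (@series_le_cvg _ _ (fun n => `|x| ^+ 2 *: wgt C n ^+ 2)).
- by move=> n; exact: sqr_ge0.
- by move=> n; rewrite mulr_ge0 ?sqr_ge0.
- move=> n; rewrite /Jop exprMn mulrC ler_wpM2r ?sqr_ge0//.
  by rewrite -[leLHS]real_normK ?num_real// lerXn2r ?nnegrE// ell_le.
- by apply: is_cvg_seriesZ; exact: wgt_l2.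
Qed.

Lemma sqrtSigma_l2 u : l2 u -> l2 (sqrtSigma u).
Proof.
move=> u2; have s0 := cvg_series_cvg_0 (@sig_summable _ _ C).
have [M [_ Mb]] := cvg_seq_bounded (cvgP _ s0).
apply: (@series_le_cvg _ _ (fun n => (M + 1) *: u n ^+ 2)).
- by move=> n; exact: sqr_ge0.
- move=> n; rewrite mulr_ge0 ?sqr_ge0//.
  by apply: le_trans (Mb (M + 1) _ n _); rewrite ?ltrDl.
- move=> n; rewrite /sqrtSigma /diagop exprMn sqr_sqrtr ?sig_ge0//.
  rewrite ler_wpM2r ?sqr_ge0// -[leLHS]ger0_norm ?sig_ge0//.
  by apply: (Mb (M + 1) _ n _); rewrite ?ltrDl.
- by apply: is_cvg_seriesZ.
Qed.

End Covariance.

(* A reproducing kernel Hilbert space of functions on T with kernel k: the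
   elements of the Hilbert space are identified with functions through the
   injective evaluation map. It is unique up to isometry (Moore-Aronszajn). *)
Record rkhs (R : realType) (T : Type) (k : T -> T -> R) := RKHS {
  hspace :> completeNormedModType R;
  hdot : {dot hspace for idfun};
  hdot_norm : forall h, `|h| ^+ 2 = hdot h h;
  heval : {linear hspace -> (T -> R^o)};
  heval_inj : injective heval;
  hker : T -> hspace;
  hkerE : forall x, heval (hker x) = k ^~ x;
  hreproducing : forall h x, heval h x = hdot h (hker x)
}.

Definition feature_dist (R : realType) (P : metricPair R) (B : completion P)
    (C : covData B) (t : R) (H : rkhs (kJS C t)) (g h : KXA P) : R :=
  `|hker H (cembed B (KtoV g)) - hker H (cembed B (KtoV h))|.

Section Covering.
Context (R : realType) (T : Type) (m : T -> T -> R).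

Definition oball (c : T) (r : \bar R) : set T := [set y | ((m c y)%:E < r)%E].

(* The infimum of a nonempty set of naturals is attained; it is +oo when no
   finite cover exists. *)
Definition covering_number (S : set T) (r : \bar R) : \bar R :=
  ereal_inf [set (n%:R)%:E | n in
    [set n | exists c : 'I_n -> T, S `<=` \bigcup_i oball (c i) r]].

End Covering.

(* Main.v *)
Require Import Defs.
From mathcomp Require Import finmap multiset sesquilinear.
From mathcomp Require Import all_boot all_order all_algebra.
From mathcomp Require Import all_classical all_reals all_analysis.
From mathcomp Require Import lra.

Set Implicit Arguments.
Unset Strict Implicit.
Unset Printing Implicit Defensive.

Import Order.TTheory GRing.Theory Num.Theory.
Import numFieldNormedType.Exports.

Local Open Scope classical_set_scope.
Local Open Scope ring_scope.

(** The feature map is Lipschitz from the Wasserstein metric to the kernel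
    metric, with constant [Num.sqrt t * |Sigma^(1/2) J|]. Hence each rho-ball
    of the radius on the right lies in the feature ball of radius [eps] with
    the same centre, and any cover by the former is a cover by the latter
    ([covering_number_le]).

    The Lipschitz bound has three factors. In the reproducing kernel Hilbert
    space the reproducing property gives
    [|k_x - k_y|^2 = 2 - 2 k(x, y)] ([feature_sqr]), and [1 - exp (- s) <= s]
    turns this into [|k_x - k_y| <= sqrt t * |Sigma^(1/2) J (x - y)|]. The
    operator norm of Sigma^(1/2) J, which is finite because
    [|ell_n(x)| <= |x|], the weights are square summable and the eigenvalues of
    Sigma are bounded, bounds this by a multiple of [|x - y|]
    ([SJ_le_opnorm], [feature_le]). Finally the easy half
    of Kantorovich duality bounds the norm of [g - h] by [rho g h]: a
    1-Lipschitz function vanishing at the base point, integrated against the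
    difference of the marginals of a coupling, gives at most the cost of that
    coupling ([vpair_coupling], [W1norm_le_rho]). *)

Lemma covering_number_le (R : realType) (T : Type) (m m' : T -> T -> R)
    (S : set T) (r r' : \bar R) :
  (forall c, oball m c r `<=` oball m' c r') ->
  (covering_number m' S r' <= covering_number m S r)%E.
Proof.
move=> sub; apply: ereal_inf_le_tmp => _ [n [c Sc] <-]; exists n => //; exists c.
by move=> x /Sc [i _ xi]; exists i => //; exact: sub.
Qed.

Section Transport.
Context (R : realType) (P : metricPair R).

Lemma fcm_map_big (T T' : choiceType) (M : nmodType) (f : T -> T') (F : T' -> M)
    (m : freeCM T) :
  \sum_(y <- (fcm_map f m : multiset T')) F y =
  \sum_(x <- (m : multiset T)) F (f x).
Proof.
elim/fcm_ind: m => [|x m ih]; first by rewrite fcm_map0 !fcm_big0.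
by rewrite fcm_mapD fcm_map_gen !fcm_big !fcm_big_gen ih.
Qed.

Lemma vpair_DtoV (f : collapse P -> R) (m : freeCM P) : f (base P) = 0 ->
  vpair f (DtoV (toD m)) = \sum_(x <- (m : multiset P)) f (toq x).
Proof.
move=> f0; rewrite DtoV_toD; elim/fcm_ind: m => [|x m ih].
  rewrite !fcm_big0; have := vpair_linear f0 (-1) 0 0.
  by rewrite scaler0 addr0 mulN1r addNr.
rewrite !fcm_big !fcm_big_gen -ih -[evec _]scale1r vpair_linear// mul1r.
by rewrite vpair_evec.
Qed.

(** Summing the Lipschitz inequality over the pairs of the coupling. The mass
    that a coupling may add or remove in A is invisible to [f], because [f]
    vanishes at the base point. *)
Lemma vpair_coupling (f : collapse P -> R) (a b : DXA P) s : Lip1_based f ->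
  coupling a b s -> vpair f (DtoV a - DtoV b) <= cost s.
Proof.
move=> [f0 fL] [<- <-].
rewrite addrC -scaleN1r vpair_linear// mulN1r addrC !vpair_DtoV// !fcm_map_big.
rewrite -sumrB; apply: ler_sum => p _; rewrite -mdist_toq.
by apply: le_trans (fL _ _); exact: ler_norm.
Qed.

(** Writing [g = a - b] and [h = c - d] gives [g - h = (a + d) - (c + b)] in the
    vector space, and [a + d], [c + b] are the two measures whose transport
    cost defines [rho g h]. *)
Lemma W1norm_le_rho (g h : KXA P) : (W1norm (KtoV g - KtoV h)%R <= (rho g h)%:E)%E.
Proof.
apply: ge_ereal_sup => _ [f fL <-]; rewrite lee_fin /rho.
have -> : KtoV g - KtoV h =
    DtoV ((repr g).1 + (repr h).2) - DtoV ((repr h).1 + (repr g).2).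
  by rewrite /KtoV !DtoVD !opprD opprK addrACA [- _ + DtoV _]addrC addrACA.
apply: lb_le_inf => [|_ [s sab <-]]; first exact: cost_neq0.
exact: vpair_coupling.
Qed.

Lemma cembed_dist_le_rho (B : completion P) (g h : KXA P) :
  `|cembed B (KtoV g) - cembed B (KtoV h)| <= rho g h.
Proof. by rewrite -raddfB -lee_fin cembed_isometry; exact: W1norm_le_rho. Qed.

End Transport.

Section Hilbert.
Context (R : realType).

Let sqr_scale (c : R) (u : nat -> R) :
  (fun n => (c * u n) ^+ 2) = c ^+ 2 *: (fun n => u n ^+ 2).
Proof. by apply/funext => n; rewrite exprMn. Qed.

Lemma l2Z (c : R) (u : nat -> R) : l2 u -> l2 (fun n => c * u n).
Proof. by move=> u2; rewrite /l2/= sqr_scale; exact: is_cvg_seriesZ. Qed.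

Lemma l2normZ (c : R) (u : nat -> R) :
  l2 u -> l2norm (fun n => c * u n) = `|c| * l2norm u.
Proof.
move=> u2; rewrite /l2norm sqr_scale lim_seriesZ//.
by rewrite [_ *: _]/(_ * _) sqrtrM ?sqr_ge0// sqrtr_sqr.
Qed.

Lemma l2norm_le (u v : nat -> R) : l2 v -> (forall n, `|u n| <= `|v n|) ->
  l2norm u <= l2norm v.
Proof.
move=> v2 uv.
have sq n : u n ^+ 2 <= v n ^+ 2.
  by rewrite -(real_normK (num_real (u n))) -(real_normK (num_real (v n)))
    lerXn2r ?nnegrE.
have u2 : l2 u by apply: series_le_cvg sq v2 => n; exact: sqr_ge0.
by rewrite ler_wsqrtr//; exact: lim_series_le.
Qed.

Context (B : normedModType R) (C : covData B).

Lemma SJ_l2 x : l2 (SJ C x).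
Proof. by apply: sqrtSigma_l2; exact: Jop_l2. Qed.

Lemma SJZ c x : SJ C (c *: x) = fun n => c * SJ C x n.
Proof.
by apply/funext => n; rewrite /SJ /sqrtSigma /diagop /Jop linearZ/= !mulrA
  (mulrC c) -!mulrA (mulrCA c).
Qed.

Lemma l2norm_SJ0 : l2norm (SJ C 0) = 0.
Proof.
by rewrite -[0 in LHS](scale0r (0 : B)) SJZ l2normZ ?normr0 ?mul0r//; exact: SJ_l2.
Qed.

Lemma l2norm_SJN x : l2norm (SJ C (- x)) = l2norm (SJ C x).
Proof. by rewrite -scaleN1r SJZ l2normZ ?normrN1 ?mul1r//; exact: SJ_l2. Qed.

(** Since [|ell_n(x)| <= |x|] for all n, the sequence of the weights, rescaled by
    the square roots of the eigenvalues, dominates [Sigma^(1/2) J x]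
    coordinatewise; it therefore bounds the operator norm. *)
Lemma SJ_le (x : B) :
  l2norm (SJ C x) <= `|x| * l2norm (sqrtSigma C (wgt C)).
Proof.
have w2 : l2 (sqrtSigma C (wgt C)) by apply: sqrtSigma_l2; exact: wgt_l2.
rewrite -[(`|x|)]normr_id -l2normZ//; apply: l2norm_le; first exact: l2Z.
move=> n; rewrite /SJ /sqrtSigma /diagop /Jop !normrM normr_id mulrA.
by rewrite [leRHS]mulrC ler_wpM2l// ell_le.
Qed.

Lemma SJnorm_ge0 : (0 <= SJnorm C)%E.
Proof. by apply: ereal_sup_ubound; exists 0; rewrite /= ?normr0// l2norm_SJ0. Qed.

Lemma SJnorm_fin_num : SJnorm C \is a fin_num.
Proof.
rewrite ge0_fin_numE ?SJnorm_ge0//.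
apply: (@le_lt_trans _ _ (l2norm (sqrtSigma C (wgt C)))%:E); last exact: ltry.
apply: ge_ereal_sup => _ [x /= x1 <-]; rewrite lee_fin.
by apply: le_trans (SJ_le x) _; rewrite ler_piMl// sqrtr_ge0.
Qed.

Lemma SJ_le_opnorm (x : B) : l2norm (SJ C x) <= fine (SJnorm C) * `|x|.
Proof.
have [->|x0] := eqVneq x 0.
  by rewrite l2norm_SJ0 normr0 mulr0.
have nx : 0 < `|x| by rewrite normr_gt0.
rewrite -ler_pdivrMr// mulrC -[(`|x|^-1)]ger0_norm ?invr_ge0//.
rewrite -l2normZ; last exact: SJ_l2.
rewrite -SJZ -lee_fin fineK ?SJnorm_fin_num//.
apply: ereal_sup_ubound; exists (`|x|^-1 *: x) => //=.
by rewrite normrZ ger0_norm ?invr_ge0// mulVf// gt_eqF.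
Qed.

(** Expansion of the square with the reproducing property; the kernel is
    symmetric and equals 1 on the diagonal. *)
Lemma feature_sqr (t : R) (H : rkhs (kJS C t)) (x y : B) :
  `|hker H x - hker H y| ^+ 2 = 2 - 2 * kJS C t x y.
Proof.
have k1 z : kJS C t z z = 1.
  by rewrite /kJS subrr l2norm_SJ0 expr0n/= mulr0 oppr0 expR0.
have kC : kJS C t y x = kJS C t x y by rewrite /kJS -opprB l2norm_SJN.
have dotE z w : hdot H (hker H z) (hker H w) = kJS C t w z.
  by rewrite -hreproducing hkerE.
rewrite hdot_norm linearBl !linearBr/= !dotE !k1 kC; lra.
Qed.

Lemma feature_le (t : R) (H : rkhs (kJS C t)) (x y : B) : 0 <= t ->
  `|hker H x - hker H y| <= Num.sqrt t * fine (SJnorm C) * `|x - y|.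
Proof.
move=> t0; apply: (@le_trans _ _ (Num.sqrt t * l2norm (SJ C (x - y)))).
  rewrite -ler_sqr ?nnegrE ?mulr_ge0 ?sqrtr_ge0//.
  rewrite feature_sqr exprMn sqr_sqrtr// /kJS.
  set s := l2norm _ ^+ 2; have := expR_ge1Dx (- (t / 2 * s)); lra.
by rewrite -mulrA ler_wpM2l ?sqrtr_ge0// SJ_le_opnorm.
Qed.

End Hilbert.

Theorem theorem4p6 (R : realType) (P : metricPair R)
    (sepXA : separable (collapse P))
    (nudXA : ~ uniformly_discrete (collapse P))
    (B : completion P) (C : covData B)
    (t : R) (t_gt0 : 0 < t) (H : rkhs (kJS C t))
    (S : set (KXA P)) (S_neq0 : S !=set0)
    (eps : R) (eps_gt0 : 0 < eps) :
  (covering_number (feature_dist H) S eps%:E <=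
   covering_number (@rho R P) S
     (if SJnorm C == 0 then +oo
      else (eps / (Num.sqrt t * fine (SJnorm C)))%:E))%E.
Proof.
have M0 : 0 <= fine (SJnorm C) by apply: fine_ge0; exact: SJnorm_ge0.
have lip g h : feature_dist H g h <= Num.sqrt t * fine (SJnorm C) * rho g h.
  apply: le_trans (feature_le H _ _ (ltW t_gt0)) _.
  by rewrite ler_wpM2l ?mulr_ge0 ?sqrtr_ge0 ?cembed_dist_le_rho.
apply: covering_number_le => g h; rewrite /oball/= lte_fin.
(* Radius +oo: all points have the same feature vector, at distance 0. *)
have [M_eq0 _|M_neq0] := eqVneq (SJnorm C) 0%E.
  by apply: le_lt_trans (lip g h) _; rewrite M_eq0 mulr0 mul0r.
have M_gt0 : 0 < fine (SJnorm C).
  rewrite lt_neqAle M0 andbT eq_sym; apply: contra M_neq0 => /eqP fM.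
  by rewrite -(fineK (SJnorm_fin_num C)) fM.
rewrite lte_fin ltr_pdivlMr ?mulr_gt0 ?sqrtr_gt0// mulrC.
exact: le_lt_trans.
Qed.
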